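(* Let $\varepsilon$ be a real number with $0<\varepsilon<1$. Then there is a constant $C(\varepsilon)>0$, depending only on $\varepsilon$, such that the following holds. Let $x$ and $z$ be real numbers with $x\geq 3$ and $(\ln x)^{\varepsilon}\leq z\leq x$. Let $k$ be a positive integer, let $a_0,\ldots,a_k$ be integers with $|a_i|\leq x$ for all $0\leq i\leq k$, and $a_k\neq 0$. Let $\delta$ denote the greatest common divisor of $a_0,\ldots,a_k$, and let \[ R(n)=a_kn^k+a_{k-1}n^{k-1}+\ldots+a_0. \] Let $s$ be a positive integer. Then \[ \sum_{\substack{-z\leq n\leq z\\ R(n)\neq 0}}\left(\frac{|R(n)|}{\varphi(|R(n)|)}\right)^{s}\leq\left(C(\varepsilon)\frac{\delta}{\varphi(\delta)}\ln(k+1)\right)^{s}s!\,z, \] where the sum is over integers $n$.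
   Context: $\varphi$ is Euler's totient function; $\ln$ is the natural logarithm. *)

(* Defs.v *)
From mathcomp Require Import all_boot all_order all_algebra.
From mathcomp Require Import all_classical all_reals all_analysis.

Set Implicit Arguments.
Unset Strict Implicit.
Unset Printing Implicit Defensive.

Import Order.TTheory GRing.Theory Num.Theory.
Local Open Scope ring_scope.

Definition poly_val (k : nat) (a : 'I_k.+1 -> int) (n : int) : int :=
  \sum_(i < k.+1) a i * n ^+ i.

(* [gcdn] has neutral element [0], so this is the usual nonnegative gcd. *)
Definition coef_gcd (k : nat) (a : 'I_k.+1 -> int) : nat :=
  \big[gcdn/0%N]_(i < k.+1) `|a i|%N.

(* Only meaningful for [0 < m]: at [m = 0] it is [0 / 0 = 0]. *)
Definition totient_ratio (R : realType) (m : nat) : R :=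
  m%:R / (totient m)%:R.

(* Main.v *)
Require Import Defs.
From mathcomp Require Import all_boot all_order all_algebra.
From mathcomp Require Import all_classical all_reals all_analysis.
From mathcomp Require Import ring lra zify.

(** The ratio [m / phi m] is the product of [(1 - 1 / p)^-1] over the primes
[p] dividing [m]. Up to an absolute constant factor it is the exponential of
the sum of [1 / p] over these primes, and it is never smaller than that
exponential ([totient_ratio_le], [totient_ratio_ge]). The theorem is therefore
a statement about the sum of [1 / p] over the primes dividing [R n], which is
split into ranges, with [J = O(s * ln (k + 1))].

- The primes dividing [delta] account for the factor [delta / phi delta].

- The primes [p <= 2 ^ J] contribute at most [ln J + 6] by Mertens' second
  theorem ([mertens2]), hence a factor [O(s * ln (k + 1))]. Raised to the power
  [s] this gives [s ^ s], and [s ^ s <= e ^ s * s!] is where the factorial in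
  the bound comes from.

- The primes exceeding both [2 ^ J] and [z] contribute [O(1 / eps)]. With
  [Y = (k + 1) * ln x], each such [p <= Y] satisfies [ln Y = O(ln p / eps)],
  because [p > k] and [p > (ln x) ^ eps]; so Mertens' first theorem
  ([mertens1]) bounds the sum over [p <= Y]. The primes beyond [Y] contribute
  [O(1)] since [ln |R n| = O(Y)].

- The primes [2 ^ J < p <= z] not dividing [delta] are handled on average over
  [n]. Such a [p] divides [R n] for at most [4 * k * z / p] of the [n], since
  [R] has at most [k] zeros modulo [p] ([count_roots_mod]). Nothing is known
  about several primes dividing [R n] simultaneously, as their product may
  exceed [z]. Convexity of the exponential makes this unnecessary: the sum of
  [1 / (p * ln p)] over [p > 2 ^ J] is [O(1 / J)], so for [J] a large multiple
  of [s] the numbers [2 * s / (p * ln p)] are weights of total at most [1], and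
  Jensen's inequality bounds [exp (s * \sum 1 / p)] by [1] plus a sum of terms
  that each involve a single prime ([exp_moment_le]).

The estimates for primes all follow from two divisibilities: the primes in
[(n, 2 n]] divide the central binomial coefficient, and [p ^ (n %/ p)] divides
[n!]. Ranges are cut at powers of [2] throughout. *)

Set Implicit Arguments.
Unset Strict Implicit.
Unset Printing Implicit Defensive.

Import Order.TTheory GRing.Theory Num.Theory.
Local Open Scope classical_set_scope.
Local Open Scope ring_scope.

(** * Sums over sublists, factorials and Jensen's inequality *)

Lemma ler_sum_subset (R : realType) (T : eqType) (r1 r2 : seq T)
    (P1 P2 : pred T) (F : T -> R) :
  uniq r1 -> uniq r2 ->
  (forall x, x \in r1 -> P1 x -> (x \in r2) && P2 x) ->
  (forall x, x \in r2 -> P2 x -> 0 <= F x) ->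
  \sum_(x <- r1 | P1 x) F x <= \sum_(x <- r2 | P2 x) F x.
Proof.
move=> u1 u2 sub F0; rewrite -[leLHS]big_filter -[leRHS]big_filter.
set s1 := [seq x <- r1 | P1 x]; set s2 := [seq x <- r2 | P2 x].
have us1 : uniq s1 by rewrite filter_uniq.
have us2 : uniq s2 by rewrite filter_uniq.
have sub' : {subset s1 <= s2}.
  by move=> x; rewrite !mem_filter => /andP[Px xr]; rewrite andbC sub.
have s12 : perm_eq [seq x <- s2 | x \in s1] s1.
  apply: uniq_perm; rewrite ?filter_uniq// => x.
  by rewrite mem_filter; case: (boolP (x \in s1)) => //= /sub' ->.
rewrite -(perm_big _ s12) big_filter [leRHS](bigID (mem s1)) /=.
rewrite lerDl big_seq_cond; apply: sumr_ge0 => x /andP[].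
by rewrite mem_filter => /andP[Px xr] _; exact: F0.
Qed.

Lemma expn_le_expR_fact (R : realType) (s : nat) :
  (s%:R : R) ^+ s <= expR 1 ^+ s * s`!%:R.
Proof.
elim: s => [|s IH]; first by rewrite !expr0 mul1r.
have [->|s0] := posnP s.
  by rewrite !expr1 mulr1; have := expR_ge1Dx (1 : R); lra.
have step : (s.+1%:R : R) ^+ s <= expR 1 * s%:R ^+ s.
  have sR : (0 : R) < s%:R by rewrite ltr0n.
  have -> : s.+1%:R = (1 + s%:R^-1) * s%:R :> R.
    by rewrite mulrDl mulVf ?gt_eqF// mul1r -natr1 addrC.
  rewrite exprMn ler_pM2r ?exprn_gt0//.
  rewrite -[X in expR X](@mulfV _ s%:R) ?gt_eqF// expRM_natl.
  by apply: lerXn2r; rewrite ?nnegrE ?expR_ge0 ?expR_ge1Dx.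
rewrite exprS (le_trans (ler_wpM2l _ step)) ?ler0n//.
rewrite factS natrM exprS.
have -> : expR 1 * expR 1 ^+ s * (s.+1%:R * s`!%:R) =
  s.+1%:R * (expR 1 * (expR 1 ^+ s * s`!%:R)) :> R by ring.
by rewrite ler_wpM2l ?ler0n// ler_wpM2l ?expR_ge0.
Qed.

(** Jensen's inequality for the exponential: every weighted tangent line at the
mean [m] lies below the graph; the missing weight [1 - \sum w] sits at [0]. *)
Lemma expR_jensen (R : realType) (T : Type) (r : seq T) (P : pred T)
    (w t : T -> R) :
  (forall x, P x -> 0 <= w x) -> \sum_(x <- r | P x) w x <= 1 ->
  expR (\sum_(x <- r | P x) w x * t x) <=
    1 + \sum_(x <- r | P x) w x * (expR (t x) - 1).
Proof.
move=> w0 w1; set m := \sum_(x <- r | P x) w x * t x.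
set W := \sum_(x <- r | P x) w x in w1 *.
have tangent u : expR m * (1 + u - m) <= expR u.
  rewrite -[X in _ <= expR X](subrKC m) expRD ler_wpM2l ?expR_ge0//.
  by have := expR_ge1Dx (u - m); lra.
have Wsum : \sum_(x <- r | P x) w x * expR (t x) >=
    expR m * (W + m - m * W).
  have -> : expR m * (W + m - m * W) =
      \sum_(x <- r | P x) w x * (expR m * (1 + t x - m)).
    have -> : W + m - m * W = \sum_(x <- r | P x) (w x + w x * t x - m * w x).
      by rewrite sumrB big_split /= -mulr_sumr.
    by rewrite mulr_sumr; apply: eq_bigr => x _; ring.
  by apply: ler_sum => x Px; rewrite ler_wpM2l ?w0.
have -> : \sum_(x <- r | P x) w x * (expR (t x) - 1) =
    \sum_(x <- r | P x) w x * expR (t x) - W.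
  by rewrite -sumrB; apply: eq_bigr => x _; rewrite mulrBr mulr1.
have := tangent 0; rewrite expR0 addr0 => t0.
have := ler_wpM2l (_ : 0 <= 1 - W) t0; rewrite subr_ge0 => /(_ w1).
rewrite mulr1; move: Wsum; set E := expR m; set S := \sum_(x <- r | P x) _.
move=> h1 h2; have -> : E = E * (W + m - m * W) + (1 - W) * (E * (1 - m)).
  by ring.
lra.
Qed.

(** * Chebyshev and Mertens estimates over dyadic ranges *)

Local Open Scope nat_scope.

Lemma dvdn_prod_prime_powers (r : seq nat) (e : nat -> nat) (m : nat) :
  0 < m -> uniq r -> all prime r -> (forall p, p \in r -> e p <= logn p m) ->
  \prod_(p <- r) p ^ e p %| m.
Proof.
move=> m0; elim: r => [|p r IH] /=; first by rewrite big_nil dvd1n.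
case/andP=> pr ur /andP[pp pr'] h; rewrite big_cons Gauss_dvd.
  rewrite pfactor_dvdn// h ?mem_head//=; apply: IH => // q qr.
  by apply: h; rewrite inE qr orbT.
rewrite big_seq; apply: (big_ind (coprime (p ^ e p))).
- by rewrite coprimen1.
- by move=> a b ca cb; rewrite coprimeMr ca.
- move=> q qr; apply: coprimeXl; apply: coprimeXr.
  rewrite prime_coprime// dvdn_prime2 ?(allP pr' q qr)//.
  by apply: contraNneq pr => ->.
Qed.

Lemma prime_dvd_fact (p n : nat) : prime p -> (p %| n`!) = (p <= n).
Proof.
move=> pp; apply/idP/idP; last by move=> pn; rewrite dvdn_fact ?prime_gt0.
elim: n => [|n IH]; first by rewrite fact0 dvdn1 => /eqP p1; rewrite p1 in pp.
rewrite factS Euclid_dvdM// => /orP[/dvdn_leq->//|/IH /leqW//].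
Qed.

Lemma logn_central_binomial (n p : nat) :
  prime p -> n < p <= n.*2 -> 0 < logn p 'C(n.*2, n).
Proof.
move=> pp /andP[np p2n].
have C0 : 0 < 'C(n.*2, n) by rewrite bin_gt0 -addnn leq_addr.
rewrite -pfactor_dvdn// expn1.
have := bin_fact (_ : n <= n.*2); rewrite -{1}addnn leq_addr => /(_ isT) E.
have : p %| (n.*2)`! by rewrite prime_dvd_fact.
rewrite -E !Euclid_dvdM// !prime_dvd_fact// -addnn addnK [p <= n]leqNgt np.
by rewrite !orbF.
Qed.

Lemma central_binomial_le (n : nat) : 'C(n.*2, n) <= 2 ^ n.*2.
Proof.
have nn : n < n.*2.+1 by rewrite ltnS -addnn leq_addr.
rewrite -[2]/(1 + 1) expnDn (bigD1 (Ordinal nn)) //=.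
by rewrite !exp1n !muln1 leq_addr.
Qed.

Local Open Scope ring_scope.

(** Open on the left and closed on the right, so that the dyadic ranges
[(2 ^ j, 2 ^ j.+1]] concatenate. *)
Definition prime_sum (R : realType) (F : nat -> R) (a b : nat) : R :=
  \sum_(a.+1 <= p < b.+1 | prime p) F p.

Lemma prime_sum_cat (R : realType) (F : nat -> R) (a b c : nat) :
  (a <= b)%N -> (b <= c)%N ->
  prime_sum F a c = prime_sum F a b + prime_sum F b c.
Proof. by move=> ab bc; rewrite /prime_sum (@big_cat_nat _ _ _ b.+1). Qed.

Lemma prime_sumZ (R : realType) (F : nat -> R) (c : R) (a b : nat) :
  prime_sum (fun p => c * F p) a b = c * prime_sum F a b.
Proof. by rewrite /prime_sum mulr_sumr. Qed.

Lemma prime_sum_le (R : realType) (F G : nat -> R) (a b : nat) :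
  (forall p, prime p -> (a < p <= b)%N -> F p <= G p) ->
  prime_sum F a b <= prime_sum G a b.
Proof.
move=> FG; rewrite /prime_sum big_nat_cond [leRHS]big_nat_cond.
by apply: ler_sum => p /andP[ab pp]; exact: FG.
Qed.

Lemma prime_sum_subset (R : realType) (r : seq nat) (P : pred nat)
    (F : nat -> R) (a b : nat) :
  uniq r ->
  (forall p, p \in r -> P p -> prime p && (a < p <= b)%N) ->
  (forall p, prime p -> 0 <= F p) ->
  \sum_(p <- r | P p) F p <= prime_sum F a b.
Proof.
move=> ur rP F0; apply: ler_sum_subset => //; first exact: iota_uniq.
  by move=> p pr Pp; rewrite mem_index_iota ltnS andbC rP.
by move=> p _ pp; exact: F0.
Qed.

Lemma lnX2 (R : realType) (j : nat) : ln (2 ^ j)%:R = j%:R * ln 2 :> R.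
Proof. by rewrite natrX lnXn// mulr_natl. Qed.

Lemma ln2_gt0 (R : realType) : 0 < ln 2 :> R.
Proof. by rewrite ln_gt0// ltr1n. Qed.

Lemma ln2_ge_half (R : realType) : 2^-1 <= ln 2 :> R.
Proof.
have : ln (1 + - 2^-1) <= - 2^-1 :> R by apply: le_ln1Dx; lra.
have -> : 1 + - 2^-1 = 2^-1 :> R by lra.
by rewrite lnV ?posrE//; lra.
Qed.

Lemma ler_ln_nat (R : realType) (m n : nat) :
  (0 < m)%N -> (m <= n)%N -> ln m%:R <= ln n%:R :> R.
Proof.
by move=> m0 mn; rewrite ler_ln ?posrE ?ltr0n ?ler_nat// (leq_trans m0).
Qed.

Lemma ln_nat_ge0 (R : realType) (n : nat) : 0 <= ln n%:R :> R.
Proof. by case: n => [|n]; [rewrite ln0|rewrite ln_ge0// ler1n]. Qed.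

Lemma ln_prime_gt0 (R : realType) (p : nat) : prime p -> 0 < ln p%:R :> R.
Proof. by move=> pp; rewrite ln_gt0// ltr1n prime_gt1. Qed.

Lemma ln_prime_ge (R : realType) (j p : nat) :
  (2 ^ j < p)%N -> j%:R * ln 2 <= ln p%:R :> R.
Proof. by move=> jp; rewrite -lnX2 ler_ln_nat ?expn_gt0// ltnW. Qed.

Lemma ln_prod_powers (R : realType) (r : seq nat) (e : nat -> nat) :
  all prime r ->
  ln (\prod_(p <- r) p ^ e p)%:R = \sum_(p <- r) (e p)%:R * ln p%:R :> R.
Proof.
elim: r => [|p r IH] /=; first by rewrite !big_nil ln1.
move=> /andP[pp pr]; rewrite !big_cons natrM lnM ?posrE ?ltr0n ?IH//.
- by rewrite natrX lnXn ?ltr0n ?prime_gt0// mulr_natl.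
- by rewrite expn_gt0 prime_gt0.
- rewrite big_seq prodn_cond_gt0// => q qr.
  by rewrite expn_gt0 prime_gt0// (allP pr).
Qed.

(** The powers [p ^ e p] are pairwise coprime divisors of [m], so their product
is at most [m]. *)
Lemma sum_ln_le_of_logn (R : realType) (a b m : nat) (e : nat -> nat) :
  (0 < m)%N ->
  (forall p, prime p -> (a < p <= b)%N -> (e p <= logn p m)%N) ->
  prime_sum (fun p => (e p)%:R * ln p%:R : R) a b <= ln m%:R.
Proof.
move=> m0 h; rewrite /prime_sum -big_filter.
set r := [seq _ <- _ | _].
have pr : all prime r by apply/allP=> p; rewrite mem_filter => /andP[].
rewrite -ln_prod_powers// ler_ln_nat//.
  rewrite big_seq prodn_cond_gt0// => q qr.
  by rewrite expn_gt0 prime_gt0// (allP pr).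
apply: dvdn_leq => //; apply: dvdn_prod_prime_powers => //.
  by rewrite filter_uniq// iota_uniq.
by move=> p; rewrite mem_filter mem_index_iota ltnS => /andP[]; exact: h.
Qed.

(** Chebyshev's argument: every prime in [(n, 2 n]] divides the binomial
coefficient ['C(n.*2, n)], which is at most [4 ^ n]. *)
Lemma theta_dyadic (R : realType) (j : nat) :
  prime_sum (fun p => ln p%:R) (2 ^ j) (2 ^ j.+1) <=
    (2 ^ j.+1)%:R * ln 2 :> R.
Proof.
have -> : (2 ^ j.+1 = (2 ^ j).*2)%N by rewrite expnS mul2n.
set n := (2 ^ j)%N.
have C0 : (0 < 'C(n.*2, n))%N by rewrite bin_gt0 -addnn leq_addr.
rewrite -lnX2; apply: le_trans (ler_ln_nat R C0 (central_binomial_le n)).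
have := @sum_ln_le_of_logn R n n.*2 _ (fun=> 1%N) C0.
move=> /(_ (fun p pp np => logn_central_binomial pp np)).
by under [X in X <= _ -> _]eq_bigr do rewrite mul1r.
Qed.

Lemma theta_le (R : realType) (J : nat) :
  prime_sum (fun p => ln p%:R) 0 (2 ^ J) <= (2 ^ J.+1)%:R * ln 2 :> R.
Proof.
elim: J => [|J IH].
  rewrite /prime_sum big_ltn_cond// big_geq//=.
  by rewrite mulr_ge0 ?ler0n// ltW// ln2_gt0.
rewrite (@prime_sum_cat _ _ _ (2 ^ J)%N) ?leq_exp2l//.
have := lerD IH (theta_dyadic R J); rewrite -mulrDl -natrD addnn -mul2n.
by rewrite -expnS.
Qed.

(** Mertens' first theorem, upper half: [p] divides [n`!] at least [n %/ p]
times, and replacing [n %/ p] by [n / p] costs at most the Chebyshev sum. *)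
Lemma mertens1 (R : realType) (J : nat) :
  prime_sum (fun p => ln p%:R / p%:R) 0 (2 ^ J) <= (J%:R + 2) * ln 2 :> R.
Proof.
set n := (2 ^ J)%N.
have n0 : (0 < n)%N by rewrite expn_gt0.
have nR : (0 : R) < n%:R by rewrite ltr0n.
have factn : ln (n`!)%:R <= n%:R * (J%:R * ln 2) :> R.
  rewrite -lnX2 -/n mulr_natl -lnXn// -natrX ler_ln_nat ?fact_gt0//.
  rewrite fact_prod -[X in (_ <= _ ^ X)%N](subn1 n.+1).
  rewrite -[X in (_ <= X)%N]prod_nat_const_nat.
  by rewrite big_nat_cond [leqRHS]big_nat_cond leq_prod// => i /andP[/andP[]].
have le_logn p : prime p -> (0 < p <= n)%N -> (n %/ p <= logn p n`!)%N.
  move=> pp _; rewrite logn_fact// big_ltn ?ltnS// expn1; exact: leq_addr.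
have h1 := sum_ln_le_of_logn R (fact_gt0 n) le_logn.
rewrite -(ler_pM2l nR) -prime_sumZ.
apply: (@le_trans _ _ (prime_sum (fun p => (n %/ p)%:R * ln p%:R) 0 n +
                       prime_sum (fun p => ln p%:R) 0 n)).
  rewrite -big_split/=; apply: prime_sum_le => p pp _.
  have pR : (0 : R) < p%:R by rewrite ltr0n prime_gt0.
  have -> : n%:R * (ln p%:R / p%:R) = n%:R / p%:R * ln p%:R :> R by ring.
  rewrite -[X in _ + X]mul1r -mulrDl ler_wpM2r ?ln_nat_ge0//.
  rewrite ler_pdivrMr// natr1 -natrM ler_nat ltnW// ltn_ceil// prime_gt0//.
apply: le_trans (lerD (le_trans h1 factn) (theta_le R J)) _.
by rewrite expnS natrM -/n; lra.
Qed.

(** Mertens' second theorem, upper half, by partial summation over dyadic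
blocks: on the block above [2 ^ j], [1 / p] is at most
[1 / (j * ln 2)] times the summand of the first theorem. *)
Lemma mertens2 (R : realType) (J : nat) : (0 < J)%N ->
  prime_sum (fun p => p%:R^-1) 0 (2 ^ J) <= ln J%:R + 6 :> R.
Proof.
move=> J0; pose S j : R := prime_sum (fun p => ln p%:R / p%:R) 0 (2 ^ j).
have l2 := ln2_gt0 R.
(* The boundary term of the partial summation is kept, so that the induction on
   [J] adds one block at a time. *)
suff H : prime_sum (fun p => p%:R^-1) 0 (2 ^ J) <=
    S J / (J%:R * ln 2) + ln J%:R + 3 * (1 - J%:R^-1).
  apply: le_trans H _.
  have JR : (1 : R) <= J%:R by rewrite ler1n.
  have : S J / (J%:R * ln 2) <= 1 + 2 * J%:R^-1.
    rewrite ler_pdivrMr ?mulr_gt0 ?ltr0n//; apply: le_trans (mertens1 R J) _.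
    rewrite mulrA ler_pM2r// mulrDl mul1r -mulrA mulVf ?mulr1//.
    by rewrite gt_eqF// ltr0n.
  have : J%:R^-1 >= 0 :> R by rewrite invr_ge0.
  have : J%:R^-1 <= 1 :> R by rewrite invf_le1// ltr0n.
  lra.
elim: J J0 => // -[_ _|J IH _].
  have only2 (F : nat -> R) : prime_sum F 0 (2 ^ 1) = F 2%N.
    by rewrite expn1 /prime_sum big_ltn_cond//= big_ltn_cond//= big_geq ?addr0.
  rewrite /S !only2 ln1 mul1r invr1 subrr mulr0 !addr0.
  by rewrite mulrAC divff ?mul1r// gt_eqF.
have {}IH := IH isT; set j := J.+1 in IH *.
have jR : (0 : R) < j%:R by rewrite ltr0n.
have j1R : (0 : R) < j.+1%:R by rewrite ltr0n.
rewrite (@prime_sum_cat _ _ _ (2 ^ j)%N) ?leq_exp2l//.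
have block : prime_sum (fun p => p%:R^-1) (2 ^ j) (2 ^ j.+1) <=
    (S j.+1 - S j) / (j%:R * ln 2).
  have -> : S j.+1 - S j =
      prime_sum (fun p => ln p%:R / p%:R) (2 ^ j) (2 ^ j.+1).
    by rewrite /S (@prime_sum_cat _ _ _ (2 ^ j)%N) ?leq_exp2l// addrC addKr.
  rewrite mulrC -prime_sumZ; apply: prime_sum_le => p pp /andP[jp _].
  rewrite mulrA ler_peMl ?invr_ge0//.
  by rewrite mulrC ler_pdivlMr ?mulr_gt0// mul1r ln_prime_ge.
have hS := mertens1 R j.+1; rewrite -/(S j.+1) in hS.
have hln : j.+1%:R^-1 <= ln j.+1%:R - ln j%:R :> R.
  have E : 1 + - j.+1%:R^-1 = j%:R / j.+1%:R :> R.
    by rewrite -[in LHS]natr1 -[in RHS]natr1; field; rewrite natr1 gt_eqF.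
  have i1 : j.+1%:R^-1 < 1 :> R by rewrite invf_lt1 ?ltr1n.
  have : ln (1 + - j.+1%:R^-1) <= - j.+1%:R^-1 :> R.
    by apply: le_ln1Dx; rewrite ltrN2.
  rewrite E ln_div ?posrE//; move: (ln _) (ln _) (_^-1) => *; lra.
set T := prime_sum _ 0 _ in IH *; set b := prime_sum _ _ _ in block *.
have key : S j.+1 / (j%:R * ln 2) - S j.+1 / (j.+1%:R * ln 2) <=
    j.+1%:R^-1 + 3 * (j%:R^-1 - j.+1%:R^-1).
  have -> : S j.+1 / (j%:R * ln 2) - S j.+1 / (j.+1%:R * ln 2) =
      S j.+1 / (j%:R * j.+1%:R * ln 2).
    by rewrite -natr1; field; rewrite natr1 !gt_eqF.
  rewrite ler_pdivrMr ?mulr_gt0//; apply: le_trans hS _.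
  rewrite le_eqVlt; apply/orP; left; apply/eqP.
  by rewrite -natr1; field; rewrite natr1 !gt_eqF.
rewrite mulrBl in block; move: IH hln key block.
move: (S j.+1 / (j.+1%:R * ln 2)) (S j.+1 / (j%:R * ln 2))
  (S j / (j%:R * ln 2)) (ln j.+1%:R) (ln j%:R) (j.+1%:R^-1) (j%:R^-1) => *.
lra.
Qed.

(** By Chebyshev's bound the block above [2 ^ j] contributes [O(1 / j ^ 2)]; the
induction on [J'] sums this as a telescoping series. *)
Lemma prime_sum_inv_xlnx (R : realType) (J J' : nat) :
  (0 < J)%N -> (J <= J')%N ->
  prime_sum (fun p => (p%:R * ln p%:R)^-1) (2 ^ J) (2 ^ J') <= 8 / J%:R :> R.
Proof.
move=> J0; have l2 := ln2_gt0 R.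
have JR : (0 : R) < J%:R by rewrite ltr0n.
suff H : (J <= J')%N ->
    prime_sum (fun p => (p%:R * ln p%:R)^-1) (2 ^ J) (2 ^ J') <=
      4 / ln 2 * (J%:R^-1 - J'%:R^-1) :> R.
  move=> JJ; apply: le_trans (H JJ) _.
  have h : 4 / ln 2 <= 8 :> R.
    by rewrite ler_pdivrMr//; have := ln2_ge_half R; lra.
  have J'0 : 0 <= J'%:R^-1 :> R by rewrite invr_ge0.
  have dJ : 0 <= J%:R^-1 - J'%:R^-1 :> R.
    by rewrite subr_ge0 lef_pV2 ?posrE ?ltr0n ?ler_nat// (leq_trans J0).
  apply: le_trans (ler_wpM2r dJ h) _; rewrite ler_pM2l//; lra.
elim: J' => [|j IH]; first by rewrite leqn0 => /eqP J00; rewrite J00 in J0.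
rewrite leq_eqVlt => /predU1P[<-|].
  by rewrite /prime_sum big_geq// subrr mulr0.
rewrite ltnS => Jj; have j0 : (0 < j)%N by exact: leq_trans Jj.
have jR : (0 : R) < j%:R by rewrite ltr0n.
rewrite (@prime_sum_cat _ _ _ (2 ^ j)%N) ?leq_exp2l//.
have -> : J%:R^-1 - j.+1%:R^-1 =
  (J%:R^-1 - j%:R^-1) + (j%:R^-1 - j.+1%:R^-1) :> R by ring.
rewrite mulrDr lerD ?IH//.
pose c : R := ((2 ^ j)%:R * (j%:R * ln 2) ^+ 2)^-1.
have e2 : (0 : R) < (2 ^ j)%:R by rewrite ltr0n expn_gt0.
have jl : 0 < j%:R * ln 2 :> R by rewrite mulr_gt0.
apply: (@le_trans _ _ (prime_sum (fun p => c * ln p%:R) (2 ^ j) (2 ^ j.+1))).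
  apply: prime_sum_le => p pp /andP[jp _].
  have pR : (0 : R) < p%:R by rewrite ltr0n prime_gt0.
  have lp := ln_prime_gt0 R pp.
  have -> : (p%:R * ln p%:R)^-1 = (p%:R * ln p%:R ^+ 2)^-1 * ln p%:R :> R.
    by field; rewrite !gt_eqF.
  rewrite ler_wpM2r ?(ltW lp)// lef_pV2 ?posrE ?mulr_gt0 ?exprn_gt0//.
  apply: ler_pM; rewrite ?ler0n ?exprn_ge0 ?(ltW jl) ?ler_nat 1?ltnW//.
  by apply: lerXn2r; rewrite ?nnegrE ?(ltW jl) ?(ltW lp)// ln_prime_ge.
rewrite prime_sumZ; apply: le_trans (ler_wpM2l _ (theta_dyadic R j)) _.
  by rewrite invr_ge0 mulr_ge0// ?exprn_ge0// ltW.
have -> : c * ((2 ^ j.+1)%:R * ln 2) = 2 / ln 2 * (j%:R ^+ 2)^-1.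
  rewrite /c expnS natrM; field; rewrite !gt_eqF//.
have -> : 4 / ln 2 * (j%:R^-1 - j.+1%:R^-1) =
    2 / ln 2 * (2 * (j%:R * j.+1%:R)^-1) :> R.
  by rewrite -[j.+1%:R]natr1; field; rewrite natr1 !gt_eqF// ltr0n.
rewrite ler_pM2l ?divr_gt0// -[leRHS]invf_div.
rewrite lef_pV2 ?posrE ?divr_gt0 ?exprn_gt0 ?mulr_gt0 ?ltr0n//.
rewrite ler_pdivrMr//.
have : 1 <= j%:R :> R by rewrite ler1n.
rewrite -[j.+1%:R]natr1; nra.
Qed.

(** The same sum over an arbitrary range: the bound does not depend on the upper
end, so that end may be rounded up to a power of [2]. *)
Lemma prime_sum_inv_xlnx_le (R : realType) (J b : nat) : (0 < J)%N ->
  prime_sum (fun p => (p%:R * ln p%:R)^-1) (2 ^ J) b <= 8 / J%:R :> R.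
Proof.
move=> J0; have leJ := leq_addr (up_log 2 b) J.
apply: le_trans (prime_sum_inv_xlnx R J0 leJ).
apply: prime_sum_subset; first exact: iota_uniq.
- move=> p; rewrite mem_index_iota ltnS => /andP[-> pb] ->/=.
  apply: leq_trans pb (leq_trans (up_logP b (isT : 1 < 2)%N) _).
  by rewrite leq_exp2l// leq_addl.
- by move=> p pp; rewrite invr_ge0 mulr_ge0// ln_nat_ge0.
Qed.

(** * The totient ratio and reciprocals of prime divisors *)

Definition inv_primes (R : realType) (m : nat) : R :=
  \sum_(p <- primes m) p%:R^-1.

Lemma totient_ratio_prod (R : realType) (m : nat) : (0 < m)%N ->
  totient_ratio R m = \prod_(p <- primes m) (p%:R / p.-1%:R).
Proof.
move=> m0; rewrite /totient_ratio totientE//.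
rewrite {1}(prod_prime_decomp m0) prime_decompE big_map/=.
rewrite !natr_prod -prodf_div big_seq [RHS]big_seq; apply: eq_bigr => p.
rewrite mem_primes => /and3P[pp _ pm].
have lp : (0 < logn p m)%N by rewrite logn_gt0 mem_primes pp m0.
have p1 : p.-1%:R != 0 :> R.
  by rewrite pnatr_eq0 -lt0n -subn1 subn_gt0 prime_gt1.
have pR : p%:R != 0 :> R by rewrite pnatr_eq0 -lt0n prime_gt0.
rewrite -{1}(prednK lp) expnS !natrM natrX; field.
by rewrite p1 expf_neq0.
Qed.

(** The exponents [1 / p.-1] and [1 / p] differ by a telescoping sum, whence the
absolute constant [1] in the exponent. *)
Lemma totient_ratio_le (R : realType) (m : nat) : (0 < m)%N ->
  totient_ratio R m <= expR (1 + inv_primes R m).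
Proof.
move=> m0; rewrite totient_ratio_prod//.
have gap : \sum_(p <- primes m) (p.-1%:R^-1 - p%:R^-1) <= 1 :> R.
  apply: (@le_trans _ _
      (\sum_(2 <= i < m.+2) (i.-1%:R^-1 - i%:R^-1 : R))).
    apply: ler_sum_subset => //; first exact: primes_uniq.
    - exact: iota_uniq.
    - move=> p; rewrite mem_primes andbT => /and3P[pp _ pm] _.
      by rewrite mem_index_iota prime_gt1//= ltnS (leq_trans (dvdn_leq _ pm)).
    - move=> i; rewrite mem_index_iota => /andP[i2 _] _.
      rewrite subr_ge0 lef_pV2 ?posrE ?ltr0n ?ler_nat ?leq_pred//.
        by rewrite (leq_trans _ i2).
      by rewrite -subn1 subn_gt0.
  rewrite big_add1/= (eq_bigr (fun i => - i.+1%:R^-1 - - i%:R^-1)); last first.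
    by move=> i _; rewrite opprK addrC.
  by rewrite telescope_sumr// invr1 opprK gerDr oppr_le0 invr_ge0.
apply: (@le_trans _ _ (expR (\sum_(p <- primes m) p.-1%:R^-1))); last first.
  by rewrite ler_expR; move: gap; rewrite sumrB /inv_primes; lra.
rewrite expR_sum big_seq [leRHS]big_seq; apply: ler_prod => p.
rewrite mem_primes => /andP[pp _]; rewrite divr_ge0//=.
apply: le_trans (expR_ge1Dx _); have p1 : 0 < p.-1%:R :> R.
  by rewrite ltr0n -subn1 subn_gt0 prime_gt1.
rewrite ler_pdivrMr// mulrDl mul1r mulVf ?gt_eqF//.
by rewrite natr1 prednK ?prime_gt0.
Qed.

Lemma totient_ratio_ge (R : realType) (m : nat) : (0 < m)%N ->
  expR (inv_primes R m) <= totient_ratio R m.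
Proof.
move=> m0; rewrite totient_ratio_prod// expR_sum big_seq [leRHS]big_seq.
apply: ler_prod => p; rewrite mem_primes => /andP[pp _].
have p1 : 0 < p.-1%:R :> R by rewrite ltr0n -subn1 subn_gt0 prime_gt1.
have pR : 0 < p%:R :> R by rewrite ltr0n prime_gt0.
rewrite expR_ge0/= -[leRHS]invf_div -[leLHS]invrK -expRN.
rewrite lef_pV2 ?posrE ?expR_gt0 ?divr_gt0//.
apply: le_trans (expR_ge1Dx _).
rewrite ler_pdivrMr// mulrDl mulNr mul1r mulVf ?gt_eqF//.
by rewrite -subn1 natrB ?prime_gt0.
Qed.

Lemma totient_ratio_ge0 (R : realType) (m : nat) : 0 <= totient_ratio R m.
Proof. by rewrite divr_ge0. Qed.

(** On these primes [1 / p] is at most [1 / D] times the summand [ln p / p] of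
Mertens' first theorem. *)
Lemma prime_sum_inv_large (R : realType) (r : seq nat) (P : pred nat)
    (j : nat) (D : R) :
  uniq r -> 0 < D ->
  (forall p, p \in r -> P p -> [&& prime p, (p <= 2 ^ j)%N & D <= ln p%:R]) ->
  \sum_(p <- r | P p) p%:R^-1 <= (j%:R + 2) * ln 2 / D.
Proof.
move=> ur D0 rP.
apply: (@le_trans _ _ (\sum_(p <- r | P p) D^-1 * (ln p%:R / p%:R))).
  rewrite big_seq_cond [leRHS]big_seq_cond; apply: ler_sum => p /andP[pr Pp].
  have /and3P[pp _ Dp] := rP p pr Pp.
  by rewrite mulrA ler_peMl ?invr_ge0// mulrC ler_pdivlMr// mul1r.
rewrite -mulr_sumr mulrC ler_pM2r ?invr_gt0//; apply: le_trans (mertens1 R j).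
apply: prime_sum_subset => // p; last first.
  by move=> pp; rewrite divr_ge0// ln_nat_ge0.
by move=> pr Pp; have /and3P[pp pj _] := rP p pr Pp; rewrite pp prime_gt0.
Qed.

(** Each of these [1 / p] is at most [ln p / (ln 2 * Y)], and the logarithms of
all primes dividing [m] add up to at most [ln m]. *)
Lemma inv_primes_tail (R : realType) (m : nat) (P : pred nat) (Y : R) :
  (0 < m)%N -> 0 < Y -> (forall p, P p -> Y <= p%:R) ->
  \sum_(p <- primes m | P p) p%:R^-1 <= ln m%:R / (ln 2 * Y).
Proof.
move=> m0 Y0 YP; have l2 := ln2_gt0 R.
have lnm : \sum_(p <- primes m) ln p%:R <= ln m%:R :> R.
  rewrite {2}(prod_prime_decomp m0) prime_decompE big_map/=.
  rewrite ln_prod_powers; last first.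
    by apply/allP=> p; rewrite mem_primes => /andP[].
  rewrite big_seq [leRHS]big_seq; apply: ler_sum => p.
  move=> pm; rewrite -[leLHS]mul1r ler_wpM2r ?ln_nat_ge0// ler1n.
  by rewrite logn_gt0.
rewrite mulrC; apply: (@le_trans _ _
    ((ln 2 * Y)^-1 * \sum_(p <- primes m) ln p%:R)); last first.
  by rewrite ler_wpM2l// invr_ge0 ltW// mulr_gt0.
rewrite mulr_sumr.
apply: (@le_trans _ _
    (\sum_(p <- primes m | P p) (ln 2 * Y)^-1 * ln p%:R)); last first.
  apply: ler_sum_subset; rewrite ?primes_uniq// => p.
    by move=> ->.
  by rewrite mulr_ge0 ?ln_nat_ge0// invr_ge0 ltW// mulr_gt0.
rewrite big_seq_cond [leRHS]big_seq_cond; apply: ler_sum => p /andP[].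
rewrite mem_primes => /andP[pp _] /YP Yp.
have lp : ln 2 <= ln p%:R :> R by rewrite ler_ln_nat// prime_gt1.
rewrite mulrC ler_pdivlMr ?mulr_gt0// mulrC ler_pdivrMr ?ltr0n ?prime_gt0//.
by apply: ler_pM => //; exact: ltW.
Qed.

(** * Zeros modulo a prime *)

Lemma coef_gcd_dvd (k : nat) (a : 'I_k.+1 -> int) (i : 'I_k.+1) :
  (coef_gcd a %| `|a i|)%N.
Proof. by rewrite /coef_gcd (bigD1 i)//= dvdn_gcdl. Qed.

Lemma dvdn_coef_gcd (k : nat) (a : 'I_k.+1 -> int) (d : nat) :
  (forall i, (d %| `|a i|)%N) -> (d %| coef_gcd a)%N.
Proof.
move=> da; rewrite /coef_gcd; apply: (big_ind (fun m => d %| m)%N) => //.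
by move=> u v du dv; rewrite dvdn_gcd du.
Qed.

Lemma intr_Fp_eq0 (p : nat) (n : int) : prime p ->
  ((n%:~R : 'F_p) == 0) = (p %| `|n|)%N.
Proof.
move=> pp; rewrite (dvdn_pcharf (pchar_Fp pp)).
by case: (intP n) => [|m|m]; rewrite ?abszN ?absz_nat ?rmorphN ?oppr_eq0.
Qed.

(** Over the field with [p] elements the polynomial is nonzero of degree at most
[k], so each of the [n %/ p + 1] blocks of [p] consecutive integers covering the
range contains at most [k] of its zeros. *)
Lemma count_roots_mod (k : nat) (a : 'I_k.+1 -> int) (p n : nat) (c : int) :
  prime p -> ~~ (p %| coef_gcd a)%N ->
  (count (fun i => p %| `|poly_val a (i%:Z - c)|)%N (iota 0 n)
     <= (n %/ p).+1 * k)%N.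
Proof.
move=> pp pa; set Z := (fun i : nat => _).
pose P : {poly 'F_p} := \poly_(i < k.+1) (a (inord i))%:~R.
have PE u : P.[u%:~R] = (poly_val a u)%:~R.
  rewrite horner_poly /poly_val rmorph_sum/=; apply: eq_bigr => i _.
  by rewrite rmorphM rmorphXn/= inord_val.
have P0 : P != 0.
  apply: contraNneq pa => P0; apply: dvdn_coef_gcd => i.
  rewrite -intr_Fp_eq0//.
  have <- : P`_i = (a i)%:~R by rewrite coef_poly ltn_ord inord_val.
  by rewrite P0 coef0.
have block q : (count Z (iota (q * p) p) <= k)%N.
  pose g i : 'F_p := (i%:Z - c)%:~R.
  rewrite -size_filter; set s := [seq _ <- _ | _].
  have gs : uniq (map g s).
    rewrite map_inj_in_uniq ?filter_uniq ?iota_uniq// => i j.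
    rewrite !mem_filter !mem_iota => /and3P[_ i1 i2] /and3P[_ j1 j2].
    wlog ij : i j i1 i2 j1 j2 / (i <= j)%N.
      by move=> H e; case: (leqP i j) => [/H->//|/ltnW/H->].
    move/eqP; rewrite eq_sym -subr_eq0 -rmorphB/= intr_Fp_eq0//.
    have -> : (j%:Z - c - (i%:Z - c) = (j - i)%N)%R by lia.
    rewrite absz_nat => /dvdn_leq; case: (posnP (j - i)) => [|h /(_ isT)]; lia.
  have rs : all (root P) (map g s).
    apply/allP=> _ /mapP[i + ->]; rewrite mem_filter => /andP[Zi _].
    by rewrite /root /g PE intr_Fp_eq0.
  have := max_poly_roots P0 rs gs; rewrite size_map => h.
  by rewrite -ltnS (leq_trans h)// size_poly.
have blocks q : (count Z (iota 0 (q * p)) <= q * k)%N.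
  elim: q => // q IH.
  rewrite mulSnr iotaD count_cat add0n mulSnr leq_add//.
apply: leq_trans (blocks (n %/ p).+1).
have np : (n <= (n %/ p).+1 * p)%N by rewrite ltnW// ltn_ceil// prime_gt0.
by rewrite -(subnKC np) iotaD count_cat leq_addr.
Qed.

(** * Exponential moments from first moments *)

(** For large [p] only the number of points in each single event [E p] is
controlled, not joint occurrences. Writing [s / p] as the weight
[2 * s / (p * ln p)] times [ln p / 2], the weights sum to at most [1] since
[J >= 16 * s], so Jensen's inequality bounds the exponential by a linear
combination of the numbers [expR (ln p / 2) = Num.sqrt p]. *)
Lemma exp_moment_le (R : realType) (T : Type) (r : seq T) (E : nat -> pred T)
    (J b s : nat) (B : R) :
  (0 < J)%N -> (16 * s <= J)%N -> 0 <= B ->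
  (forall p, prime p -> (2 ^ J < p <= b)%N ->
     (count (E p) r)%:R * Num.sqrt p%:R <= B) ->
  \sum_(i <- r)
     expR (s%:R * \sum_((2 ^ J).+1 <= p < b.+1 | prime p && E p i) p%:R^-1)
    <= (size r)%:R + B.
Proof.
move=> J0 sJ B0 hE.
pose w p : R := 2 * s%:R * (p%:R * ln p%:R)^-1.
have w0 p : 0 <= w p.
  by rewrite !mulr_ge0// invr_ge0 mulr_ge0// ln_nat_ge0.
have w1 : prime_sum w (2 ^ J) b <= 1.
  rewrite prime_sumZ; apply: le_trans
    (ler_wpM2l _ (prime_sum_inv_xlnx_le R b J0)) _; first by rewrite mulr_ge0.
  rewrite mulrA ler_pdivrMr ?ltr0n// mul1r.
  have : (16 * s)%:R <= J%:R :> R by rewrite ler_nat.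
  by rewrite natrM; lra.
have sqrtE p : prime p -> expR (ln p%:R / 2) = Num.sqrt p%:R :> R.
  move=> pp; have E2 : p%:R = expR (ln p%:R / 2) ^+ 2 :> R.
    by rewrite -expRM_natl mulrC divfK// lnK// posrE ltr0n prime_gt0.
  by rewrite [in RHS]E2 sqrtr_sqr ger0_norm ?expR_ge0.
have sum1 (P : pred T) (c : R) :
    \sum_(i <- r | P i) c = (count P r)%:R * c.
  rewrite -sum1_count natr_sum mulr_suml.
  by apply: eq_bigr => *; rewrite mul1r.
have step i :
    expR (s%:R * \sum_((2 ^ J).+1 <= p < b.+1 | prime p && E p i) p%:R^-1) <=
    1 + \sum_((2 ^ J).+1 <= p < b.+1 | prime p && E p i) w p * Num.sqrt p%:R.
  have -> : s%:R * \sum_((2 ^ J).+1 <= p < b.+1 | prime p && E p i) p%:R^-1 =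
      \sum_((2 ^ J).+1 <= p < b.+1 | prime p && E p i) w p * (ln p%:R / 2) :> R.
    rewrite mulr_sumr; apply: eq_bigr => p /andP[pp _].
    rewrite /w; field; rewrite !gt_eqF ?ltr0n ?prime_gt0//.
    exact: ln_prime_gt0.
  apply: le_trans (expR_jensen _ _ _) _ => //.
    apply: le_trans w1; apply: ler_sum_subset; rewrite ?iota_uniq// => p.
    by move=> -> /andP[->].
  rewrite lerD2l; apply: ler_sum => p /andP[pp _].
  by rewrite sqrtE// ler_wpM2l// gerBl.
apply: le_trans (ler_sum _ (fun i _ => step i)) _.
rewrite big_split/= sum1 count_predT mulr1 lerD2l.
under eq_bigr do rewrite big_mkcondr/=.
rewrite exchange_big/=.
apply: (@le_trans _ _ (prime_sum (fun p => B * w p) (2 ^ J) b)); last first.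
  by rewrite prime_sumZ ler_piMr.
apply: prime_sum_le => p pp pJ.
rewrite -big_mkcond/= sum1 mulrCA [leRHS]mulrC ler_wpM2l//.
exact: hE.
Qed.

(** * The pointwise bound *)

Lemma ln3_ge1 (R : realType) : 1 <= ln 3 :> R.
Proof.
(* [3 >= (6 / 5) ^ 6], and [expR (1 / 6) <= 6 / 5] because
   [expR (- 1 / 6) >= 5 / 6]. *)
have h : expR (6^-1) <= 6 / 5 :> R.
  rewrite -[leLHS]invrK -expRN -invf_div lef_pV2 ?posrE ?expR_gt0 ?divr_gt0//.
  by apply: le_trans (expR_ge1Dx _); lra.
rewrite -ler_expR lnK ?posrE//.
have -> : 1 = 6%:R * 6^-1 :> R by rewrite mulfV.
rewrite expRM_natl; apply: le_trans (_ : (6 / 5) ^+ 6 <= _).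
  by apply: lerXn2r; rewrite ?nnegrE ?expR_ge0 ?divr_ge0.
lra.
Qed.

Lemma poly_val_le (R : realType) (k : nat) (a : 'I_k.+1 -> int) (n : int)
    (x : R) :
  1 <= x -> `|n|%:~R <= x -> (forall i, `|a i|%:~R <= x) ->
  `|poly_val a n|%N%:R <= k.+1%:R * x ^+ k.+1.
Proof.
move=> x1 nx ax; rewrite natr_absz /poly_val.
have x0 : 0 <= x by rewrite (le_trans _ x1).
apply: (@le_trans _ _ (\sum_(i < k.+1) x ^+ k.+1)); last first.
  by rewrite sumr_const card_ord mulr_natl.
rewrite intr_norm rmorph_sum/=; apply: le_trans (ler_norm_sum _ _ _) _.
apply: ler_sum => i _; rewrite rmorphM rmorphXn/= normrM normrX -!intr_norm.
rewrite exprS; apply: ler_pM => //; rewrite ?exprn_ge0 ?ler0z//.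
apply: (@le_trans _ _ (x ^+ i)); last by rewrite ler_weXn2l// -ltnS.
by apply: lerXn2r; rewrite ?nnegrE ?ler0z.
Qed.

Lemma coef_gcd_gt0 (k : nat) (a : 'I_k.+1 -> int) :
  a ord_max != 0 -> (0 < coef_gcd a)%N.
Proof.
rewrite -absz_gt0 => a0; have := coef_gcd_dvd a ord_max.
by case: (coef_gcd a) => //; rewrite dvd0n => /eqP E; rewrite E in a0.
Qed.

Lemma inv_primes_split (R : realType) (m d : nat) (J b : nat) :
  inv_primes R m =
    \sum_(p <- primes m | (p %| d)%N) p%:R^-1
  + \sum_(p <- primes m | ~~ (p %| d)%N && (p <= 2 ^ J)%N) p%:R^-1
  + \sum_(p <- primes m | ~~ (p %| d)%N && (2 ^ J < p <= b)%N) p%:R^-1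
  + \sum_(p <- primes m | [&& ~~ (p %| d)%N, 2 ^ J < p & b < p]%N) p%:R^-1.
Proof.
rewrite /inv_primes (bigID (fun p => p %| d)%N)/= -!addrA; congr +%R.
rewrite (bigID (fun p => p <= 2 ^ J)%N)/=; congr +%R.
rewrite (bigID (fun p => p <= b)%N)/=.
by congr +%R; apply: eq_bigl => p; rewrite -?ltnNge -?andbA// -ltnNge.
Qed.

(** Rounding [Y] up to a power of [2] costs only a constant factor in the bound
[(j + 2) * ln 2] of Mertens' first theorem. *)
Lemma up_log_real (R : realType) (Y : R) : 2 <= Y ->
  exists2 j : nat, Y <= (2 ^ j)%:R & (j%:R + 2) * ln 2 <= 4 * ln Y.
Proof.
move=> Y2; have Y0 : 0 <= Y by lra.
have [tY Yt] := (truncn_le Y, truncnS_gt Y); rewrite Y0 in tY.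
set t := Num.truncn Y in tY Yt.
have t2 : (1 < t.+1)%N by rewrite -(ltr_nat R); apply: le_lt_trans Yt; lra.
have /andP[lo hi] := up_log_bounds (isT : 1 < 2)%N t2.
exists (up_log 2 t.+1); first by rewrite (le_trans (ltW Yt))// ler_nat.
have l2 : ln 2 <= ln Y by rewrite ler_ln ?posrE//; lra.
have l20 := ln2_gt0 R.
set j := up_log _ _ in lo hi *.
have hj : j.-1%:R * ln 2 <= ln Y.
  rewrite -lnX2 ler_ln ?posrE ?ltr0n ?expn_gt0//; last lra.
  by apply: le_trans tY; rewrite ler_nat -ltnS.
have -> : j%:R = j.-1%:R + 1 :> R.
  by rewrite natr1 prednK// /j up_log_gt0 t2.
lra.
Qed.

(** All primes dividing [R n] are disposed of here except those to be averaged
over [n], which remain in the last exponential. The constant [15 + 4 / eps]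
collects [1] from [totient_ratio_le], [6] from [mertens2], and for the primes
beyond both [2 ^ J] and [z] the amounts [4 * (1 + 1 / eps)] up to
[Y = (k + 1) * ln x] and [4] after it. *)
Lemma totient_ratio_poly_val_le (R : realType) (eps x z : R) (k : nat)
    (a : 'I_k.+1 -> int) (n : int) (J : nat) :
  0 < eps -> 3 <= x -> ln x `^ eps <= z -> z <= x -> (0 < k)%N ->
  (forall i, `|a i|%:~R <= x) -> a ord_max != 0 ->
  `|n|%:~R <= z -> poly_val a n != 0 -> (0 < J)%N -> (k < 2 ^ J)%N ->
  totient_ratio R `|poly_val a n|%N <=
    expR (15 + 4 / eps) * J%:R * totient_ratio R (coef_gcd a) *
    expR (\sum_((2 ^ J).+1 <= p < (Num.truncn z).+1 |
            prime p && (~~ (p %| coef_gcd a)%N && (p %| `|poly_val a n|)%N))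
            p%:R^-1).
Proof.
move=> e0 x3 xz zx k0 ax a0 nz Rn0 J0 kJ.
set m := `|poly_val a n|%N; set d := coef_gcd a.
set f := \sum_(_ <= _ < _ | _) _.
have m0 : (0 < m)%N by rewrite absz_gt0.
have d0 : (0 < d)%N by exact: coef_gcd_gt0.
have lx1 : 1 <= ln x.
  by apply: le_trans (ln3_ge1 R) _; rewrite ler_ln ?posrE//; lra.
have lx0 : 0 < ln x by lra.
have x0 : 0 < x by lra.
have k2 : 2 <= k.+1%:R :> R by rewrite ler_nat ltnS.
pose Y := k.+1%:R * ln x.
have Y2 : 2 <= Y by rewrite /Y; nra.
have [j Yj jY] := up_log_real Y2.
have lY : 0 < ln Y by rewrite ln_gt0//; lra.
have lnm : ln m%:R <= 2 * Y.
  apply: (@le_trans _ _ (ln (k.+1%:R * x ^+ k.+1))).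
    rewrite ler_ln ?posrE ?ltr0n ?mulr_gt0 ?exprn_gt0 ?ltr0n//.
    by apply: poly_val_le => //; [lra|exact: le_trans zx].
  rewrite lnM ?posrE ?exprn_gt0 ?ltr0n// lnXn// -[ln x *+ _]mulr_natl -/Y.
  have : ln k.+1%:R < k.+1%:R :> R by rewrite ln_sublinear// ltr0n.
  by rewrite /Y; nra.
have h_d : \sum_(p <- primes m | (p %| d)%N) p%:R^-1 <= inv_primes R d.
  apply: ler_sum_subset; rewrite ?primes_uniq// => p.
  by rewrite !mem_primes d0 andbT/= => /andP[-> _] ->.
have h_small : \sum_(p <- primes m | ~~ (p %| d)%N && (p <= 2 ^ J)%N) p%:R^-1
    <= ln J%:R + 6 :> R.
  apply: le_trans (mertens2 R J0); apply: prime_sum_subset => //.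
    exact: primes_uniq.
  move=> p; rewrite mem_primes => /andP[pp _] /andP[_ ->].
  by rewrite pp prime_gt0.
have h_mid : \sum_(p <- primes m |
    ~~ (p %| d)%N && (2 ^ J < p <= Num.truncn z)%N) p%:R^-1 <= f.
  apply: ler_sum_subset; rewrite ?primes_uniq ?iota_uniq// => p.
  rewrite mem_primes mem_index_iota ltnS => /and3P[-> _ pm] /andP[-> ->].
  by rewrite pm.
have h_large : \sum_(p <- primes m |
    [&& ~~ (p %| d)%N, 2 ^ J < p & Num.truncn z < p]%N) p%:R^-1 <=
    4 * (1 + eps^-1) + 4 :> R.
  rewrite (bigID (fun p => p <= 2 ^ j)%N)/=; apply: lerD.
    pose D := ln Y / (1 + eps^-1).
    have ie : 0 < 1 + eps^-1 by rewrite addr_gt0 ?invr_gt0.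
    have D0 : 0 < D by rewrite divr_gt0.
    apply: le_trans (prime_sum_inv_large (j := j) (primes_uniq m) D0 _) _.
      move=> p; rewrite mem_primes => /and3P[pp _ _] /andP[/and3P[_ pJ pz] pj].
      rewrite pp pj/= /D ler_pdivrMr// /Y lnM ?posrE ?ltr0n//.
      have pR : 0 < p%:R :> R by rewrite ltr0n prime_gt0.
      have h1 : ln k.+1%:R <= ln p%:R :> R.
        by rewrite ler_ln_nat// (leq_trans kJ)// ltnW.
      have h2 : ln (ln x) <= ln p%:R * eps^-1.
        rewrite ler_pdivlMr// mulrC -ln_powR ler_ln ?posrE ?powR_gt0//.
        apply: le_trans xz _; apply: ltW; apply: lt_le_trans (truncnS_gt z) _.
        by rewrite ler_nat.
      by rewrite mulrDr mulr1 lerD.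
    by rewrite ler_pdivrMr// /D -mulrA [X in 4 * X]mulrC divfK// gt_eqF.
  apply: (@le_trans _ _ (ln m%:R / (ln 2 * Y))).
    apply: inv_primes_tail => //; first lra.
    move=> p /andP[_]; rewrite -ltnNge => /ltnW jp.
    by rewrite (le_trans Yj)// ler_nat.
  have l2 := ln2_ge_half R.
  rewrite ler_pdivrMr; last by rewrite mulr_gt0 ?ln2_gt0//; lra.
  by apply: le_trans lnm _; nra.
have JR : (0 : R) < J%:R by rewrite ltr0n.
apply: le_trans (totient_ratio_le R m0) _.
apply: (@le_trans _ _
    (expR (15 + 4 / eps) * expR (ln J%:R) * expR (inv_primes R d) * expR f)).
  rewrite -!expRD ler_expR (inv_primes_split R m d J (Num.truncn z)).
  move: h_d h_small h_mid h_large; set s1 := \sum_(_ <- _ | _) _.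
  set s2 := \sum_(_ <- _ | _) _; set s3 := \sum_(_ <- _ | _) _.
  set s4 := \sum_(_ <- _ | _) _; lra.
rewrite lnK ?posrE// ler_wpM2r ?expR_ge0// ler_wpM2l ?totient_ratio_ge//.
Qed.

(** * The main estimate *)

Lemma fsbig_poly_val (R : realType) (z : R) (k : nat) (a : 'I_k.+1 -> int)
    (F : nat -> R) :
  0 <= z ->
  \sum_(n \in [set n : int | - z <= n%:~R <= z /\ poly_val a n != 0])
     F `|poly_val a n|%N =
  \sum_(i <- iota 0 (Num.truncn z).*2.+1 |
          poly_val a (i%:Z - (Num.truncn z)%:Z) != 0)
     F `|poly_val a (i%:Z - (Num.truncn z)%:Z)|%N.
Proof.
move=> z0; set t := Num.truncn z.
pose g (i : nat) : int := i%:Z - t%:Z.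
pose r := [seq n <- map g (iota 0 t.*2.+1) | poly_val a n != 0].
have -> : [set n : int | - z <= n%:~R <= z /\ poly_val a n != 0] = [set` r].
  have tz : t%:R <= z by rewrite truncn_le.
  apply/seteqP; split => n /=.
    move=> [/andP[nz1 nz2] Rn]; rewrite mem_filter Rn andTb.
    have nt : (`|n| <= t)%N.
      by rewrite truncn_ge_nat// natr_absz intr_norm ler_norml nz1.
    by apply/mapP; exists (absz (n + t%:Z)%R); rewrite ?mem_iota /g; lia.
  rewrite mem_filter => /andP[Rn /mapP[i]]; rewrite mem_iota => /andP[_ it].
  move=> nE; split=> //; rewrite -ler_norml -intr_norm -natr_absz.
  by apply: le_trans tz; rewrite ler_nat nE /g; lia.
rewrite -fsbig_seq; last first.
  by rewrite filter_uniq// map_inj_uniq ?iota_uniq// => i j /addIr[].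
by rewrite /r big_filter big_map.
Qed.

(** A prime [p <= t] not dividing [delta] divides [R n] for at most
[4 * k * t / p] of the integers [n] with [`|n| <= t]. Once [p > 2 ^ J >= k ^ 2]
this is at most [4 * t / Num.sqrt p], which is what [exp_moment_le] asks for. *)
Lemma poly_val_moment_le (R : realType) (k : nat) (a : 'I_k.+1 -> int)
    (J t s : nat) :
  (0 < J)%N -> (16 * s <= J)%N -> (k ^ 2 <= 2 ^ J)%N -> (0 < t)%N ->
  \sum_(i <- iota 0 t.*2.+1)
    expR (s%:R * \sum_((2 ^ J).+1 <= p < t.+1 |
            prime p && (~~ (p %| coef_gcd a)%N &&
                        (p %| `|poly_val a (i%:Z - t%:Z)|)%N)) p%:R^-1)
    <= 7 * t%:R :> R.
Proof.
move=> J0 sJ kJ t0; have tR : (1 : R) <= t%:R by rewrite ler1n.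
pose E p i := ~~ (p %| coef_gcd a)%N && (p %| `|poly_val a (i%:Z - t%:Z)|)%N.
apply: le_trans (exp_moment_le (r := iota 0 t.*2.+1) (E := E) (b := t)
  (B := 4 * t%:R) J0 sJ _ _) _.
- by rewrite mulr_ge0.
- move=> p pp /andP[Jp pt]; rewrite /E.
  case: (boolP (p %| coef_gcd a)%N) => /= pd.
    by rewrite count_pred0 mul0r mulr_ge0.
  have pR : (0 : R) < p%:R by rewrite ltr0n prime_gt0.
  have sp : 0 < Num.sqrt p%:R :> R by rewrite sqrtr_gt0.
  have ksp : k%:R <= Num.sqrt p%:R :> R.
    rewrite -[k%:R]ger0_norm// -sqrtr_sqr ler_sqrt// -natrX ler_nat.
    by rewrite (leq_trans kJ)// ltnW.
  have c1 : (p * (t.*2.+1 %/ p).+1 <= 4 * t)%N.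
    rewrite mulnS mulnC; have := leq_divM t.*2.+1 p; lia.
  have := count_roots_mod t.*2.+1 t%:Z pp pd.
  rewrite -(ler_nat R) natrM => cnt.
  apply: le_trans (ler_wpM2r (ltW sp) cnt) _.
  have -> : 4 * t%:R = (4 * t)%:R :> R by rewrite natrM.
  apply: le_trans (_ : (p * (t.*2.+1 %/ p).+1)%:R <= _);
    last by rewrite ler_nat.
  rewrite natrM [leRHS]mulrC -mulrA ler_wpM2l//.
  rewrite -[leRHS]sqr_sqrtr ?(ltW pR)// expr2 ler_wpM2r// ltW//.
- rewrite size_iota -[t.*2.+1%:R]natr1 -muln2 natrM; lra.
Qed.

Theorem theorem1p3 (R : realType) (eps : R) (heps0 : 0 < eps) (heps1 : eps < 1) :
  exists C : R, 0 < C /\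
    forall (x z : R), 3 <= x -> (ln x) `^ eps <= z -> z <= x ->
    forall (k : nat), (0 < k)%N ->
    forall (a : 'I_k.+1 -> int),
      (forall i : 'I_k.+1, `|a i|%:~R <= x) ->
      a ord_max != 0 ->
    forall (s : nat), (0 < s)%N ->
      \sum_(n \in [set n : int | - z <= n%:~R <= z /\ poly_val a n != 0])
          totient_ratio R `|poly_val a n|%N ^+ s
        <= (C * totient_ratio R (coef_gcd a) * ln k.+1%:R) ^+ s * s`!%:R * z.
Proof.
pose E : R := expR (15 + 4 / eps).
(* [448 = 7 * 64]: [7] is the constant of the moment bound,
   [J <= 64 * ln (k + 1) * s], and [expR 1] comes from
   [s ^ s <= expR 1 ^ s * s`!]. *)
exists (448 * E * expR 1); split.
  have c0 : (0 : R) < 448%:R by rewrite ltr0n.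
  exact: mulr_gt0 (mulr_gt0 c0 (expR_gt0 _)) (expR_gt0 _).
move=> x z x3 xz zx k k0 a ax a0 s s0.
have lx1 : 1 <= ln x.
  by apply: le_trans (ln3_ge1 R) _; rewrite ler_ln ?posrE//; lra.
have z1 : 1 <= z.
  by apply: le_trans xz; rewrite -(powRr0 (ln x)) ler_powR// ltW.
have z0 : 0 <= z by lra.
rewrite (fsbig_poly_val a (fun m => totient_ratio R m ^+ s) z0).
set t := Num.truncn z; set d := coef_gcd a.
have centred i : (0 <= i < t.*2.+1)%N -> (`|i%:Z - t%:Z| <= t)%N.
  by move: t => t; lia.
have t0 : (0 < t)%N by rewrite truncn_gt0.
have tz : t%:R <= z by rewrite truncn_le.
(* [J] is a multiple of [16 * s] for the sake of the moment bound, and the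
   factor [L] makes [2 ^ J] exceed [k ^ 2]. *)
pose L := up_log 2 k.+1.
have k1 : (1 < k.+1)%N by [].
have /andP[Llo Lhi] := up_log_bounds (isT : 1 < 2)%N k1.
rewrite -/L in Llo Lhi.
have L0 : (0 < L)%N by rewrite up_log_gt0.
pose J := (16 * s * L)%N.
have J0 : (0 < J)%N by rewrite !muln_gt0 s0.
have sJ : (16 * s <= J)%N by rewrite leq_pmulr.
have kJ : (k ^ 2 <= 2 ^ J)%N.
  apply: (@leq_trans ((2 ^ L) ^ 2)); first by rewrite leq_sqr ltnW.
  by rewrite -expnM leq_exp2l// mulnC leq_mul// (@leq_trans 16)// leq_pmulr.
have kJ' : (k < 2 ^ J)%N.
  by rewrite (leq_trans Lhi)// leq_exp2l// leq_pmull// muln_gt0.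
have l2 := ln2_ge_half R; have l20 := ln2_gt0 R.
have lk : ln 2 <= ln k.+1%:R :> R by rewrite ler_ln_nat.
have JR : J%:R <= 64 * ln k.+1%:R * s%:R :> R.
  have : L.-1%:R * ln 2 <= ln k.+1%:R :> R.
    by rewrite -lnX2 ler_ln_nat ?expn_gt0// ltnW.
  have -> : J%:R = 16 * s%:R * (L.-1%:R + 1) :> R.
    by rewrite natr1 prednK// !natrM.
  have L1 : 0 <= L.-1%:R :> R by [].
  move=> h; have : L.-1%:R + 1 <= 4 * ln k.+1%:R :> R by nra.
  have sR : 0 <= s%:R :> R by [].
  nra.
pose f i : R := \sum_((2 ^ J).+1 <= p < t.+1 |
  prime p && (~~ (p %| d)%N && (p %| `|poly_val a (i%:Z - t%:Z)|)%N)) p%:R^-1.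
pose A : R := E * J%:R * totient_ratio R d.
have A0 : 0 <= A by rewrite !mulr_ge0 ?expR_ge0 ?totient_ratio_ge0.
apply: (@le_trans _ _
    (\sum_(i <- iota 0 t.*2.+1) A ^+ s * expR (s%:R * f i))).
  rewrite big_mkcond big_seq [leRHS]big_seq; apply: ler_sum => i.
  rewrite mem_iota => it; case: ifP => [Rn|_]; last first.
    by rewrite mulr_ge0 ?exprn_ge0 ?expR_ge0.
  rewrite expRM_natl -exprMn; apply: lerXn2r; rewrite ?nnegrE.
  - exact: totient_ratio_ge0.
  - by rewrite mulr_ge0 ?expR_ge0.
  apply: (totient_ratio_poly_val_le heps0 x3 xz zx) => //.
  by apply: le_trans tz; rewrite -natr_absz ler_nat centred.
rewrite -mulr_sumr.
apply: le_trans (ler_wpM2l (exprn_ge0 s A0)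
  (poly_val_moment_le R a J0 sJ kJ t0)) _.
pose G := E * totient_ratio R d * (64 * ln k.+1%:R).
have G0 : 0 <= G.
  by rewrite !mulr_ge0 ?expR_ge0 ?totient_ratio_ge0//; lra.
have AG : A ^+ s <= G ^+ s * (expR 1 ^+ s * s`!%:R).
  apply: (@le_trans _ _ ((G * s%:R) ^+ s)); last first.
    by rewrite exprMn ler_wpM2l ?exprn_ge0// expn_le_expR_fact.
  apply: lerXn2r; rewrite ?nnegrE ?(mulr_ge0 G0)//.
  rewrite /A /G mulrAC -[leRHS]mulrA ler_wpM2l//.
  by rewrite mulr_ge0 ?expR_ge0 ?totient_ratio_ge0.
have -> : 448 * E * expR 1 * totient_ratio R d * ln k.+1%:R =
    7 * (G * expR 1) by rewrite /G; ring.
rewrite (exprMn _ 7) (exprMn _ G).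
have c7 : 7 <= 7 ^+ s :> R by rewrite -[leLHS]expr1 ler_weXn2l// ler1n.
apply: le_trans (ler_wpM2r _ AG) _; first by rewrite mulr_ge0.
set u := G ^+ s; set v := expR 1 ^+ s; set w := s`!%:R.
have uvw : 0 <= u * v * w.
  by rewrite !mulr_ge0 ?exprn_ge0 ?expR_ge0.
have -> : u * (v * w) * (7 * t%:R) = u * v * w * (7 * t%:R) by ring.
have -> : 7 ^+ s * (u * v) * w * z = u * v * w * (7 ^+ s * z) by ring.
rewrite ler_wpM2l//; exact: ler_pM.
Qed.
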